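(* Let $\mathscr P$ be the class of all paths. A class of graphs $\mathscr C$ is an FO-transduction of $\mathscr P$ if and only if it is a perturbation of a class with bounded bandwidth. An FO-transduction $\mathscr C$ of $\mathscr P$ is FO-equivalent to $\mathscr P$ (i.e. $\mathscr C\equiv_{\rm FO}\mathscr P$) if and only if it is a perturbation of a class with bounded bandwidth that contains graphs with arbitrarily large connected components.
   Context: Graphs are finite, undirected and loopless; a class of graphs is a set of graphs considered up to isomorphism, and every class contains the empty graph. The $\ell$-th power $P^\ell$ of a graph $P$ has the same vertex set, with two distinct vertices adjacent if their distance in $P$ is at most $\ell$. The bandwidth of $G$ is $\min\{\ell:\text{there is a path }P\text{ with }P^\ell\supseteq G\}$ (subgraph containment). A class has bounded bandwidth if the bandwidths of its graphs are bounded by a constant. For a set $\mathcal U$ of unary relation symbols, a $\mathcal U$-colored graph is a graph with additional unary relations in $\mathcal U$. Formulas are first-order, with adjacency relation $E$. Transductions. For a positive integer $k$, the $k$-copy operation $\mathsf C_k$ maps a graph $G$ to the graph consisting of $k$ copies of $G$ in which the $k$ copies of each vertex are made pairwise adjacent (no other edges between the copies). The coloring operation $\Gamma_{\mathcal U}$ maps a graph to the set of all its $\mathcal U$-expansions. A simple interpretation $\mathsf I=(\nu(x),\eta(x,y))$ of graphs in $\mathcal U$-colored graphs is a pair of first-order formulas with $\eta$ symmetric and anti-reflexive; $\mathsf I(G^+)$ is the graph with vertex set $\nu(G^+)$ and edge set $\eta(G^+)\cap\nu(G^+)^2$. An (FO-)transduction is a composition $\mathsf T=\mathsf I\circ\Gamma_{\mathcal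 U}\circ\mathsf C_k$, so $\mathsf T(G)=\{\mathsf I(G^+): G^+\in\Gamma_{\mathcal U}(\mathsf C_k(G))\}$. For a class $\mathscr D$, $\mathsf T(\mathscr D)=\bigcup_{G\in\mathscr D}\mathsf T(G)$ up to isomorphism. A class $\mathscr C$ is a $\mathsf T$-transduction of $\mathscr D$ if $\mathscr C\subseteq\mathsf T(\mathscr D)$. A class $\mathscr C$ is an FO-transduction of $\mathscr D$, written $\mathscr C\sqsubseteq_{\rm FO}\mathscr D$, if $\mathscr C\subseteq\mathsf T(\mathscr D)$ for some transduction $\mathsf T$; $\mathscr C\equiv_{\rm FO}\mathscr D$ means $\mathscr C\sqsubseteq_{\rm FO}\mathscr D$ and $\mathscr D\sqsubseteq_{\rm FO}\mathscr C$. Perturbations. A subset complementation is the transduction that chooses a subset $M$ of vertices (a unary relation) and complements the adjacency inside $M$. A perturbation is a composition of a bounded number of subset complementations. A class $\mathscr C$ is a perturbation of a class $\mathscr D$ if there is a perturbation $\mathsf P$ with $\mathscr C\subseteq\mathsf P(\mathscr D)$.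
   Formalization: In the second sentence, ''perturbation of a class D'' also requires that every graph of D be perturbed into some graph of the class C; with mere inclusion it fails (C = {empty graph}, D = all paths). *)

(* Defs.v *)
From HB Require Import structures.
From mathcomp Require Import all_boot.

Set Implicit Arguments.
Unset Strict Implicit.
Unset Printing Implicit Defensive.

(** * Graphs and graph classes *)

Record graph := Graph {
  vert :> finType;
  adj : rel vert;
  adj_sym : symmetric adj;
  adj_irr : irreflexive adj }.

Definition graph_iso (G H : graph) : Prop :=
  exists2 f : G -> H, bijective f & forall x y, adj (f x) (f y) = adj x y.

(** Not necessarily induced. *)
Definition subgraph (G H : graph) : Prop :=
  exists2 f : G -> H, injective f & forall x y, adj x y -> adj (f x) (f y).

Record graph_class := GraphClass {
  in_class :> graph -> Prop;
  class_iso : forall G H, graph_iso G H -> in_class G -> in_class H;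
  class_empty : forall G : graph, #|G| = 0 -> in_class G }.

(** * Paths, powers and bandwidth *)

Definition path_adj n : rel 'I_n := [rel i j : 'I_n | (i.+1 == j :> nat) || (j.+1 == i :> nat)].

Lemma path_adj_sym n : symmetric (@path_adj n).
Proof. by move=> i j; apply: orbC. Qed.

Lemma path_adj_irr n : irreflexive (@path_adj n).
Proof. by move=> i; rewrite /path_adj /= gtn_eqF. Qed.

(** The path with [n] vertices; [n = 0] gives the empty graph, which belongs
    to every class. *)
Definition path_graph n : graph := Graph (@path_adj_sym n) (@path_adj_irr n).

Definition is_path (G : graph) : Prop := exists n, graph_iso (path_graph n) G.

Lemma graph_iso_trans G H K : graph_iso G H -> graph_iso H K -> graph_iso G K.
Proof.
move=> [f bf fE] [g bg gE]; exists (g \o f); first exact: bij_comp.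
by move=> x y; rewrite /= gE fE.
Qed.

Lemma is_path_iso G H : graph_iso G H -> is_path G -> is_path H.
Proof. by move=> GH [n nG]; exists n; apply: graph_iso_trans nG GH. Qed.

Lemma is_path_empty (G : graph) : #|G| = 0 -> is_path G.
Proof.
move=> G0; have nG (x : G) : False by have := fintype0 x G0.
have n0 (i : 'I_0) : False by case: i.
exists 0, (fun i : 'I_0 => False_rect G (n0 i)); last by move=> x; case: (n0 x).
by exists (fun x : G => False_rect 'I_0 (nG x)) => x; [case: (n0 x) | case: (nG x)].
Qed.

Definition paths : graph_class := GraphClass is_path_iso is_path_empty.

(** [dist_le l x y]: some walk with at most [l] edges joins [x] to [y]. *)
Definition dist_le (G : graph) l (x y : G) : bool :=
  [exists p : {bseq l of G}, path (@adj G) x p && (last x p == y)].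

Definition power_adj (G : graph) l : rel G :=
  [rel x y | (x != y) && dist_le l x y].

Lemma dist_le_sym (G : graph) l : symmetric (@dist_le G l).
Proof.
suff imp (x y : G) : dist_le l x y -> dist_le l y x.
  by move=> x y; apply/idP/idP; apply: imp.
case/existsP=> p /andP[xp /eqP <-].
have szq : size (rev (belast x p)) <= l.
  by rewrite size_rev size_belast size_bseq.
apply/existsP; exists (Bseq szq); rewrite /= rev_path.
apply/andP; split; first by rewrite (eq_path (e' := @adj G)) // => u v; exact: adj_sym.
by case: (bseqval p) => [|z s] //=; rewrite rev_cons last_rcons.
Qed.

Lemma power_adj_sym (G : graph) l : symmetric (@power_adj G l).
Proof. by move=> x y; rewrite /power_adj /= eq_sym dist_le_sym. Qed.

Lemma power_adj_irr (G : graph) l : irreflexive (@power_adj G l).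
Proof. by move=> x; rewrite /power_adj /= eqxx. Qed.

Definition power (G : graph) l : graph :=
  Graph (@power_adj_sym G l) (@power_adj_irr G l).

Definition fits_path_power (G : graph) l : Prop :=
  exists2 P, is_path P & subgraph G (power P l).

Definition is_bandwidth (G : graph) l : Prop :=
  fits_path_power G l /\ forall m, fits_path_power G m -> l <= m.

Definition bounded_bandwidth (D : graph_class) : Prop :=
  exists b, forall G, D G -> exists2 l, is_bandwidth G l & l <= b.

Definition large_components (D : graph_class) : Prop :=
  forall n, exists2 G, D G & exists x : G, n <= #|connect (@adj G) x|.

(** * First-order formulas over U-colored graphs *)

(** [formula U n]: formulas whose free variables are among the [n] variables
    indexed by ['I_n]; a quantifier binds variable [0] and shifts the others. *)
Inductive formula (U : Type) : nat -> Type :=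
| FEq n of 'I_n & 'I_n : formula U n
| FAdj n of 'I_n & 'I_n : formula U n
| FColor n of U & 'I_n : formula U n
| FNot n of formula U n : formula U n
| FAnd n of formula U n & formula U n : formula U n
| FEx n of formula U n.+1 : formula U n.

Definition coloring (U : Type) (G : graph) := U -> {set G}.

Fixpoint holds U (G : graph) (c : coloring U G) n (phi : formula U n) :
    n.-tuple G -> bool :=
  match phi in formula _ m return m.-tuple G -> bool with
  | FEq _ i j => fun e => tnth e i == tnth e j
  | FAdj _ i j => fun e => adj (tnth e i) (tnth e j)
  | FColor _ u i => fun e => tnth e i \in c u
  | FNot _ psi => fun e => ~~ holds c psi e
  | FAnd _ psi1 psi2 => fun e => holds c psi1 e && holds c psi2 e
  | FEx _ psi => fun e => [exists x : G, holds c psi [tuple of x :: e]]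
  end.

(** * Transductions *)

Definition copy_adj (G : graph) k : rel (G * 'I_k)%type :=
  [rel a b | (a.2 == b.2) && adj a.1 b.1 || (a.1 == b.1) && (a.2 != b.2)].

Lemma copy_adj_sym (G : graph) k : symmetric (@copy_adj G k).
Proof. by move=> a b; rewrite /copy_adj /= adj_sym (eq_sym a.2) (eq_sym a.1). Qed.

Lemma copy_adj_irr (G : graph) k : irreflexive (@copy_adj G k).
Proof. by move=> a; rewrite /copy_adj /= adj_irr !eqxx. Qed.

Definition copy (k : nat) (G : graph) : graph :=
  Graph (@copy_adj_sym G k) (@copy_adj_irr G k).

Record simple_interp (U : Type) := SimpleInterp {
  nu : formula U 1;
  eta : formula U 2;
  eta_sym : forall (G : graph) (c : coloring U G) (x y : G),
    holds c eta [tuple x; y] = holds c eta [tuple y; x];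
  eta_irr : forall (G : graph) (c : coloring U G) (x : G),
    holds c eta [tuple x; x] = false }.

Section Interpretation.
Variables (U : Type) (I : simple_interp U) (G : graph) (c : coloring U G).

Definition interp_vert : finType := {x : G | holds c (nu I) [tuple x]}.

Definition interp_adj : rel interp_vert :=
  [rel x y | holds c (eta I) [tuple val x; val y]].

Lemma interp_adj_sym : symmetric interp_adj.
Proof. by move=> x y; apply: eta_sym. Qed.

Lemma interp_adj_irr : irreflexive interp_adj.
Proof. by move=> x; apply: eta_irr. Qed.

Definition interp : graph := Graph interp_adj_sym interp_adj_irr.

End Interpretation.

(** A map from graphs to sets of graphs. *)
Definition graph_op := graph -> graph -> Prop.

(** The image of a class, up to isomorphism. *)
Definition op_image (T : graph_op) (D : graph_class) (H : graph) : Prop :=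
  exists2 G, D G & exists2 H', T G H' & graph_iso H' H.

Record transduction := Transduction {
  symbols : Type;
  copies : nat;
  copies_gt0 : 0 < copies;
  tinterp : simple_interp symbols }.

Definition transduce (T : transduction) : graph_op := fun G H =>
  exists c : coloring (symbols T) (copy (copies T) G), H = interp (tinterp T) c.

Definition fo_transduction_of (C D : graph_class) : Prop :=
  exists T : transduction, forall H, C H -> op_image (transduce T) D H.

Definition fo_equivalent (C D : graph_class) : Prop :=
  fo_transduction_of C D /\ fo_transduction_of D C.

(** * Perturbations *)

Definition compl_adj (G : graph) (M : {set G}) : rel G :=
  [rel x y | adj x y (+) [&& x != y, x \in M & y \in M]].

Lemma compl_adj_sym (G : graph) (M : {set G}) : symmetric (compl_adj M).
Proof. by move=> x y; rewrite /compl_adj /= adj_sym eq_sym (andbC (x \in M)). Qed.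

Lemma compl_adj_irr (G : graph) (M : {set G}) : irreflexive (compl_adj M).
Proof. by move=> x; rewrite /compl_adj /= adj_irr eqxx. Qed.

Definition subset_compl (G : graph) (M : {set G}) : graph :=
  Graph (compl_adj_sym M) (compl_adj_irr M).

(** The composition of [k] subset complementations. Since [M = set0] changes
    nothing, "exactly [k]" and "at most [k]" give the same operation. *)
Fixpoint perturbation (k : nat) : graph_op :=
  if k is k'.+1 then
    fun G H => exists M : {set G}, perturbation k' (subset_compl M) H
  else fun G H => G = H.

Definition perturbation_of (C D : graph_class) : Prop :=
  exists k, forall H, C H -> op_image (perturbation k) D H.

(** [C] is a perturbation of [D] in which no graph of [D] is superfluous: each
    of them is perturbed into some graph of [C]. Without the second condition,
    graphs unrelated to [C] could be added to [D], so that no lower bound on the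
    graphs of [D] (such as [large_components D]) would say anything about [C]. *)
Definition tight_perturbation_of (C D : graph_class) : Prop :=
  exists k,
    (forall H, C H -> op_image (perturbation k) D H) /\
    (forall G, D G -> exists2 H, C H & perturbation k G H).

(* Main.v *)
Require Import Defs.
From mathcomp Require Import all_boot.
From mathcomp Require Import zify.
From Stdlib Require Import Classical.

(** First-order formulas are Gaifman-local. In the [k]-copy of a coloured path,
    the neighbourhood of a vertex of a given radius is a window of a word over a
    finite alphabet, so it takes boundedly many values, and a formula [eta(x, y)]
    evaluated at vertices that are far apart depends only on the windows of [x]
    and [y]. The interpreted graph is therefore a symmetric relation between
    window types (a sum of boundedly many subset complementations) up to edges
    joining close vertices, which form a graph of bounded bandwidth. Conversely a
    path whose vertices carry colours encodes both the edges of a graph of bounded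
    bandwidth (as lists of distances to the next neighbours) and the complemented
    subsets.

    A graph of bounded bandwidth with a large component contains a long induced
    path, which a transduction recovers from any perturbation of the graph. If
    instead all components have bounded size, then by the same locality argument,
    with the components as blocks, adjacency between distinct blocks of a
    transduced graph depends on boundedly many types only; a long path has no such
    structure, by the pigeonhole principle. *)

Set Implicit Arguments.
Unset Strict Implicit.
Unset Printing Implicit Defensive.

(** * Locality of first-order formulas *)

Section Windows.
(** A word-like structure: several elements may share a position, as the copies of a path vertex or
    the vertices of one component will, and are then told apart by their letters. *)
Variables (X L : finType) (pos : X -> nat) (lett : X -> L).
Hypothesis pos_lett_inj : forall x y, pos x = pos y -> lett x = lett y -> x = y.

Definition near l x y := (pos x <= pos y + l) && (pos y <= pos x + l).

Lemma near_sym l x y : near l x y = near l y x.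
Proof. exact: andbC. Qed.

(** Both sides of [pos z + r == pos x + d] are shifted by [r], so that offsets
    range over [-r, r] without truncated subtraction. *)
Definition window r x : L * {ffun 'I_(r + r).+1 * L -> bool} :=
  (lett x, [ffun d : 'I__ * L => [exists z, (pos z + r == pos x + d.1) && (lett z == d.2)]]).

Lemma window_transfer r x x' z : window r x = window r x' -> near r z x ->
  exists2 z', lett z' = lett z & pos z' + pos x = pos z + pos x'.
Proof.
move=> [_ /ffunP W] /andP[zx xz].
have d_lt : pos z + r - pos x < (r + r).+1 by lia.
have := W (Ordinal d_lt, lett z); rewrite !ffunE /=.
have -> : [exists y, (pos y + r == pos x + (pos z + r - pos x)) && (lett y == lett z)].
  by apply/existsP; exists z; rewrite eqxx andbT; lia.
by move/esym/existsP=> [z' /andP[/eqP pz' /eqP lz']]; exists z' => //; lia.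
Qed.

(** The window of radius [r] about [z] lies inside that of radius [s + r] about [x], so the
    translation taking [x] to [x'] carries it along. *)
Lemma window_shift s r x x' z z' :
  window (s + r) x = window (s + r) x' -> near s z x ->
  lett z' = lett z -> pos z' + pos x = pos z + pos x' ->
  window r z = window r z'.
Proof.
move=> W /andP[zx xz] lz pz; congr pair; first by rewrite lz.
apply/ffunP=> -[[d d_lt] l]; rewrite !ffunE /=.
apply/existsP/existsP=> -[y /andP[/eqP py /eqP ly]].
  have [|y' ly' py'] := window_transfer (z := y) W; first by apply/andP; split; lia.
  by exists y'; rewrite ly' ly eqxx andbT; lia.
have [|y' ly' py'] := window_transfer (z := y) (esym W); first by apply/andP; split; lia.
by exists y'; rewrite ly' ly eqxx andbT; lia.
Qed.

Lemma window_le s r x y : r <= s -> window s x = window s y -> window r x = window r y.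
Proof.
move=> /subnK <- W; apply: (window_shift W); last by rewrite addnC.
  by apply/andP; split; lia.
by case: W.
Qed.

(** The invariant of an Ehrenfeucht-Fraisse game: equal windows, and equal displacements for every
    pair close on either side. The threshold [2r + 1] still covers neighbouring positions when
    [r = 0]. *)
Definition similar n r (a b : n.-tuple X) :=
  (forall i, window r (tnth a i) = window r (tnth b i)) /\
  (forall i j, near (r + r).+1 (tnth a i) (tnth a j)
            || near (r + r).+1 (tnth b i) (tnth b j) ->
     pos (tnth a i) + pos (tnth b j) = pos (tnth b i) + pos (tnth a j)).

Lemma similar_sym n r (a b : n.-tuple X) : similar r a b -> similar r b a.
Proof. by move=> [W S]; split=> [i|i j]; rewrite ?W // orbC => /S ->. Qed.

Lemma similar_le n s r (a b : n.-tuple X) : r <= s -> similar s a b -> similar r a b.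
Proof.
move=> rs [W S]; split=> [i|i j nij]; first exact: window_le (W i).
by apply: S; case/orP: nij => /andP[? ?]; apply/orP; [left|right]; apply/andP; split; lia.
Qed.

Lemma similar_cons n r (a b : n.-tuple X) x y :
  similar r a b -> window r x = window r y ->
  (forall i, near (r + r).+1 x (tnth a i) || near (r + r).+1 y (tnth b i) ->
     pos x + pos (tnth b i) = pos y + pos (tnth a i)) ->
  similar r [tuple of x :: a] [tuple of y :: b].
Proof.
move=> [W S] Wxy Sxy; split=> [i|i j].
  by case: (unliftP ord0 i) => [i' ->|->]; rewrite ?tnth0 ?tnthS.
case: (unliftP ord0 i) => [i' ->|->]; case: (unliftP ord0 j) => [j' ->|->];
  rewrite ?tnth0 ?tnthS.
- exact: S.
- move=> nij; have := Sxy i'; move: nij; rewrite /near => nij H.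
  suff: pos x + pos (tnth b i') = pos y + pos (tnth a i') by lia.
  by apply: H; move: nij; rewrite ![(pos (tnth _ i') <= _) && _]andbC.
- exact: Sxy.
- by move=> _; rewrite addnC.
Qed.

(* If every copy of the window of [x] outside the neighbourhood of [a] had a
   copy only near [b], then, as the translations between [a] and [b] match the
   copies near [a] with the copies near [b], the window of [x] would occur more
   often than it does. *)
Lemma similar_extend n r (a b : n.-tuple X) x :
  similar (r + r + r).+1 a b ->
  exists y, similar r [tuple of x :: a] [tuple of y :: b].
Proof.
move=> sim_ab; have [W S] := sim_ab.
have sim_r : similar r a b by apply: similar_le sim_ab; lia.
(* Read as [(2r + 1) + r], the radius leaves a full window of radius [r] about each element within
   [2r + 1] of the tuple. *)
have W' i : window ((r + r).+1 + r) (tnth a i) = window ((r + r).+1 + r) (tnth b i).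
  by rewrite addSn.
pose nr (e : n.-tuple X) z := [exists i, near (r + r).+1 z (tnth e i)].
have [/existsP[i nxi]|far_x] := boolP (nr a x).
  have /= [|y ly py] := window_transfer (z := x) (W i).
    by case/andP: nxi => *; apply/andP; split; lia.
  exists y; apply: similar_cons => //; first exact: window_shift (W' i) nxi ly py.
  move=> j nj; suff: pos (tnth a i) + pos (tnth b j) = pos (tnth b i) + pos (tnth a j) by lia.
  by apply: S; move: nj nxi; rewrite /near; lia.
pose V := [pred z | window r z == window r x].
suff /existsP[y /andP[/eqP Vy far_y]] : [exists y, V y && ~~ nr b y].
  exists y; apply: similar_cons => // i.
  by case/orP=> ni; [case/negP: far_x|case/negP: far_y]; apply/existsP; exists i.
apply: contraT; rewrite negb_exists => /forallP allnear.
have near_b z : V z -> nr b z by move=> Vz; have := allnear z; rewrite Vz negbK.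
have back (z : {z | V z}) : exists i y,
    [/\ near (r + r).+1 (val z) (tnth b i), V y, nr a y, lett y = lett (val z) &
        pos y + pos (tnth b i) = pos (val z) + pos (tnth a i)].
  case: z => z /= Vz; have /existsP[i nzi] := near_b _ Vz.
  have [|y ly py] := window_transfer (z := z) (esym (W i)).
    by case/andP: nzi => *; apply/andP; split; lia.
  exists i, y; split=> //; last by apply/existsP; exists i; move: nzi; rewrite /near; lia.
  by rewrite /V /= -(eqP Vz) eq_sym (window_shift (esym (W' i)) nzi ly py).
have backE (z : {z | V z}) : exists y : {z | V z}, exists i,
    [/\ near (r + r).+1 (val z) (tnth b i), nr a (val y), lett (val y) = lett (val z) &
        pos (val y) + pos (tnth b i) = pos (val z) + pos (tnth a i)].
  by have [i [y [? Vy ? ? ?]]] := back z; exists (exist _ y Vy), i.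
have [g gP] := fin_all_exists backE.
have g_inj : injective g.
  move=> z z' gzz'; have [i [nz _ lz pz]] := gP z; have [i' [nz' _ lz' pz']] := gP z'.
  apply/val_inj/pos_lett_inj; last by rewrite -lz -lz' gzz'.
  (* Both [tnth a i] and [tnth a i'] are within [2r + 1] of the common image, hence within [4r + 2]
     of each other. This is below the threshold [6r + 3] of [S], so the two translations agree. *)
  have := S i i'; move: pz pz' nz nz'; rewrite -gzz' /near /=; lia.
have Vx : V x by rewrite /V /=.
have [h _ hg] := injF_bij g_inj.
have [i [_ + _ _]] := gP (h (exist _ x Vx)); rewrite hg /= => near_x.
by rewrite near_x in far_x.
Qed.

End Windows.

Arguments near {X} pos l x y.
Arguments window {X L} pos lett r x.
Arguments similar {X L} pos lett {n} r a b.

(** A formula mentions finitely many colours, listed by [g], and letters need record only these.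
    Distant vertices may be adjacent, if their letters decide it; this accommodates complemented
    subsets. *)
Definition layout U (X : graph) (c : coloring U X) (F L : finType) (g : F -> U)
    (pos : X -> nat) (lett : X -> L) :=
  [/\ forall x y, pos x = pos y -> lett x = lett y -> x = y,
      forall x y x' y', lett x = lett x' -> lett y = lett y' ->
        (near pos 1 x y || near pos 1 x' y' -> pos x + pos y' = pos x' + pos y) ->
        adj x y = adj x' y' &
      forall u x x', lett x = lett x' -> (x \in c (g u)) = (x' \in c (g u))].

(** By induction on the formula: atoms need radius 0, a conjunction the larger radius, and
    [similar_extend] takes a quantifier from [r] to [3r + 1]. All of [F], [g], [r] are chosen before
    the graph. *)
Theorem locality U n (phi : formula U n) :
  exists (F : finType) (g : F -> U) (r : nat),
  forall (X : graph) (c : coloring U X) (L : finType) (pos : X -> nat) (lett : X -> L),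
  layout c g pos lett ->
  forall a b : n.-tuple X, similar pos lett r a b -> holds c phi a = holds c phi b.
Proof.
have letters (X L : finType) pos (lett : X -> L) r m (a b : m.-tuple X) i :
  similar pos lett r a b -> lett (tnth a i) = lett (tnth b i) by case=> /(_ i) [].
elim: phi => {n} [n i j|n i j|n u i|n phi [F [g [r IH]]]|n phi [F [g [r IH]]] psi [F' [g' [r' IH']]]
                 |n phi [F [g [r IH]]]].
- exists void, (fun v : void => match v with end), 0.
  move=> X c L pos lett [inj _ _] a b sim_ab /=.
  have [la lb] := (letters _ _ _ _ _ _ _ _ i sim_ab, letters _ _ _ _ _ _ _ _ j sim_ab).
  have := sim_ab.2 i j; rewrite /near => H.
  apply/eqP/eqP => e.
    by apply: inj; last (by rewrite -la -lb e); move: H; rewrite e; lia.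
  by apply: inj; last (by rewrite la lb e); move: H; rewrite e; lia.
- exists void, (fun v : void => match v with end), 0.
  move=> X c L pos lett [_ adjP _] a b sim_ab /=.
  by apply: adjP; [apply: letters sim_ab|apply: letters sim_ab|apply: sim_ab.2].
- exists unit, (fun=> u), 0 => X c L pos lett [_ _ colP] a b sim_ab /=.
  by apply: (colP tt); apply: letters sim_ab.
- exists F, g, r => X c L pos lett lay a b sim_ab /=.
  by rewrite (IH _ _ _ _ _ lay _ _ sim_ab).
- exists (F + F')%type, (fun u => match u with inl v => g v | inr v => g' v end), (maxn r r').
  move=> X c L pos lett [inj adjP colP] a b sim_ab /=.
  have lay : layout c g pos lett by split=> // u; apply: (colP (inl u)).
  have lay' : layout c g' pos lett by split=> // u; apply: (colP (inr u)).
  rewrite (IH _ _ _ _ _ lay a b) ?(IH' _ _ _ _ _ lay' a b) //.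
    by apply: similar_le sim_ab; apply: leq_maxr.
  by apply: similar_le sim_ab; apply: leq_maxl.
exists F, g, (r + r + r).+1 => X c L pos lett lay a b sim_ab /=.
have [inj _ _] := lay; apply/existsP/existsP=> -[x].
  have [y sim_xy] := similar_extend inj x sim_ab.
  by rewrite (IH _ _ _ _ _ lay _ _ sim_xy); exists y.
have [y sim_xy] := similar_extend inj x (similar_sym sim_ab).
by rewrite (IH _ _ _ _ _ lay _ _ sim_xy); exists y.
Qed.

(** For a distant pair the displacement clause of [similar] is void, so equal windows suffice. *)
Corollary locality_far U (phi : formula U 2) :
  exists (F : finType) (g : F -> U) (r : nat),
  forall (X : graph) (c : coloring U X) (L : finType) (pos : X -> nat) (lett : X -> L),
  layout c g pos lett ->
  forall x y x' y',
    window pos lett r x = window pos lett r x' ->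
    window pos lett r y = window pos lett r y' ->
    ~~ near pos (r + r).+1 x y -> ~~ near pos (r + r).+1 x' y' ->
  holds c phi [tuple x; y] = holds c phi [tuple x'; y'].
Proof.
have [F [g [r loc]]] := locality phi; exists F, g, r.
move=> X c L pos lett lay x y x' y' Wx Wy far far'; apply: (loc _ _ _ _ _ lay).
have ord2 (i : 'I_2) : (i = ord0) + (i = lift ord0 ord0).
  by case: (unliftP ord0 i) => [j|] ->; [right; rewrite ord1|left].
split=> [i|i j]; first by case: (ord2 i) => ->; rewrite ?tnth0 ?tnthS.
case: (ord2 i) (ord2 j) => -> [] ->; rewrite ?tnthS ?tnth0 ?(addnC (pos x')) ?(addnC (pos y')) //.
  by rewrite (negPf far) (negPf far').
by rewrite (near_sym _ _ y) (near_sym _ _ y') (negPf far) (negPf far').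
Qed.

(** * Perturbations and bandwidth *)

Lemma graph_iso_refl G : graph_iso G G.
Proof. by exists id => //; exists id. Qed.

Lemma graph_iso_sym G H : graph_iso G H -> graph_iso H G.
Proof.
move=> [f [g fK gK] fE]; exists g; first by exists f.
by move=> x y; rewrite -fE !gK.
Qed.

Definition compl_all (G : graph) (Ms : seq {set G}) (x y : G) : bool :=
  \big[addb/false]_(M <- Ms) [&& x != y, x \in M & y \in M].

Lemma perturbation_exists (G : graph) (Ms : seq {set G}) :
  exists2 H, perturbation (size Ms) G H &
  exists2 f : H -> G, bijective f &
  forall x y, adj x y = adj (f x) (f y) (+) compl_all Ms (f x) (f y).
Proof.
move: {2}(size Ms) (erefl (size Ms)) => k.
elim: k G Ms => [|k IH] G [|M Ms] //= sz.
  by exists G => //; exists id => [|x y]; [exists id|rewrite /compl_all big_nil addbF].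
have [H GH [f bf fE]] := IH (subset_compl M) Ms (succn_inj sz).
exists H; first by exists M.
by exists f => // x y; rewrite fE /compl_all big_cons addbA.
Qed.

Lemma perturbation_sets k (G H : graph) : perturbation k G H ->
  exists (Ms : k.-tuple {set G}) (f : H -> G), bijective f /\
  forall x y, adj x y = adj (f x) (f y) (+) compl_all Ms (f x) (f y).
Proof.
elim: k => [|k IH] in G H * => /= [<-|[M /IH[Ms [f [bf fE]]]]].
  exists [tuple], id; split=> [|x y]; first by exists id.
  by rewrite /compl_all big_nil addbF.
exists [tuple of M :: Ms], f; split=> // x y.
by rewrite fE /compl_all big_cons addbA.
Qed.

Lemma perturbation_iso k (G G' H : graph) : graph_iso G G' ->
  perturbation k G H -> exists2 H', perturbation k G' H' & graph_iso H H'.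
Proof.
elim: k => [|k IH] in G G' H * => /=; first by move=> GG' <-; exists G'.
move=> [f bf fE] [M pMH]; have f_inj := bij_inj bf.
have [|H' pH' HH'] := IH _ (subset_compl (f @: M)) _ _ pMH.
  by exists f => // x y; rewrite /= /compl_adj /= fE !mem_imset // inj_eq.
by exists H' => //; exists (f @: M).
Qed.

(** Over the two-element field a symmetric matrix is a sum of matrices [v v^T]. The induction
    removes one nonzero entry and its mirror image at a time. *)
Lemma symmetric_sum_squares (T : finType) (s : rel T) : symmetric s ->
  exists q : pred {set T},
  forall a b, s a b = \big[addb/false]_(A | q A) ((a \in A) && (b \in A)).
Proof.
pose ok (s : rel T) := exists q : pred {set T},
  forall a b, s a b = \big[addb/false]_(A | q A) ((a \in A) && (b \in A)).
have okD s1 s2 : ok s1 -> ok s2 -> ok (fun a b => s1 a b (+) s2 a b).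
  move=> [q1 e1] [q2 e2]; exists (fun A => q1 A (+) q2 A) => a b.
  rewrite e1 e2 (big_mkcond q1) (big_mkcond q2) -big_split [RHS]big_mkcond /=.
  by apply: eq_bigr => A _; case: (q1 A) (q2 A) => -[] /=; rewrite ?addbF ?addbb.
have ok1 (A : {set T}) : ok (fun a b => (a \in A) && (b \in A)).
  by exists (pred1 A) => a b; rewrite big_pred1_eq.
have ok_eq s1 s2 : (forall a b, s1 a b = s2 a b) -> ok s2 -> ok s1.
  by move=> e [q e2]; exists q => a b; rewrite e.
have [m] := ubnP #|[set p | s p.1 p.2]|; elim: m s => // m IH s ltm s_sym.
have [/eqP s0|/set0Pn[[a b]]] := boolP ([set p | s p.1 p.2] == set0).
  exists pred0 => a b; rewrite big_pred0_eq; apply: contraFF _ (in_set0 (a, b)).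
  by rewrite -s0 inE.
rewrite inE /= => sab.
pose e c d := ((c == a) && (d == b)) || ((c == b) && (d == a)).
(* Off the diagonal, the pair {a, b} is the sum of the squares of {a, b}, {a}
   and {b}. *)
have ok_e : ok e.
  have [eab|nab] := eqVneq a b.
    apply: ok_eq (ok1 [set a]) => c d.
    by rewrite /e !inE -eab orbb.
  apply: ok_eq (okD _ _ (ok1 [set a; b]) (okD _ _ (ok1 [set a]) (ok1 [set b]))) => c d.
  rewrite /e !inE; case: (eqVneq c a) => [->|ca]; case: (eqVneq d a) => [->|da] /=;
    rewrite ?(negPf nab) ?[b == a]eq_sym ?(negPf nab) //=; by do 2?case: eqP.
apply: (ok_eq _ (fun c d => (s c d (+) e c d) (+) e c d)).
  by move=> c d; rewrite -addbA addbb addbF.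
apply: okD ok_e; apply: IH; last first.
  move=> c d; rewrite s_sym /e; congr addb.
  by rewrite orbC ![(_ == b) && _]andbC ![(_ == a) && _]andbC.
rewrite -ltnS; apply: leq_trans ltm; rewrite ltnS; apply: proper_card.
apply/properP; split; last first.
  by exists (a, b); rewrite inE /= ?sab // /e !eqxx.
apply/subsetP=> -[c d]; rewrite !inE /= /e.
have [/=|_] := boolP ((c == a) && _) => [/andP[/eqP -> /eqP ->]|]; first by rewrite sab.
have [/=|_] := boolP ((c == b) && _) => [/andP[/eqP -> /eqP ->]|]; first by rewrite s_sym sab.
by rewrite addbF.
Qed.

Lemma perturbation_by_types (T : finType) (G : graph) (t : G -> T) (s : rel T) :
  symmetric s ->
  exists2 H, perturbation #|{set T}| G H &
  exists2 f : H -> G, bijective f &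
  forall x y, adj x y = adj (f x) (f y) (+) ((f x != f y) && s (t (f x)) (t (f y))).
Proof.
move=> /symmetric_sum_squares[q sE].
(* One complementation per set of types, with the empty set when [q] rejects it, so that their
   number depends on [T] alone. *)
have := perturbation_exists [seq if q A then t @^-1: A else set0 | A : {set T}].
rewrite size_map -cardE cardT => -[H pH [f bf fE]]; exists H => //; exists f => // x y.
rewrite fE; congr addb; rewrite /compl_all big_map big_enum /=.
case: eqP => _ /=; first by rewrite big1.
rewrite sE [RHS]big_mkcond; apply: eq_bigr => A _.
by case: ifP; rewrite ?inE // => _; rewrite !inE.
Qed.

(** * Bandwidth through injective numberings of the vertices *)

Lemma path_graph_dist n l (i j : path_graph n) : i <= j -> j <= i + l -> dist_le l i j.
Proof.
move=> ij jl.
suff [p [sp pp lp]] : exists p : seq (path_graph n),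
    [/\ size p = j - i, path (@adj (path_graph n)) i p & last i p = j].
  have szp : size p <= l by lia.
  by apply/existsP; exists (Bseq szp); rewrite /= pp lp eqxx.
move: {2}(j - i) (erefl (j - i)) => d; elim: d i ij {jl} => [|d IH] i ij dE.
  by exists [::]; split=> //; apply/val_inj => /=; lia.
have lt_i1 : i.+1 < n by have := ltn_ord j; lia.
have [||p [sp pp lp]] := IH (Ordinal lt_i1) => /=; [by lia|by lia|].
exists (Ordinal lt_i1 :: p); split=> //=; first by move: sp => /=; lia.
by rewrite pp andbT /path_adj /= eqxx.
Qed.

Lemma dist_le_path_graph n (P : graph) (f : path_graph n -> P) g l x y :
  cancel g f -> (forall x y, adj (f x) (f y) = adj x y) -> dist_le l x y ->
  g x <= g y + l.
Proof.
move=> gK fE /existsP[[p /= sp] /andP[pp /eqP <-]].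
elim: p l x sp pp => [|z s IH] l x /=; first by lia.
case: l => // l sl /andP[xz zs]; have := IH l z sl zs.
by move: xz; rewrite -{1}(gK x) -{1}(gK z) fE /= /path_adj /=; lia.
Qed.

(** The numbering may have gaps, since only containment in a power of a long enough path is asked.
    As [adj] is symmetric, a one-sided bound is enough. *)
Lemma fits_path_powerP (G : graph) l :
  fits_path_power G l <->
  exists2 pos : G -> nat, injective pos & forall x y, adj x y -> pos x <= pos y + l.
Proof.
split=> [[P [n [f [g fK gK] fE]] [h h_inj hE]]|[pos pos_inj posE]].
  exists (fun x => val (g (h x))) => [x y /val_inj/(can_inj gK)/h_inj //|x y /hE/andP[_]].
  exact: dist_le_path_graph.
have lt_pos x : pos x < (\max_y pos y).+1 by rewrite ltnS leq_bigmax.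
exists (path_graph (\max_y pos y).+1); first by exists (\max_y pos y).+1, id; [exists id|].
exists (fun x => Ordinal (lt_pos x)) => [x y [/pos_inj] //|x y xy].
apply/andP; split.
  by apply: contraTneq xy => -[/pos_inj ->]; rewrite adj_irr.
have [le|/ltnW le] := leqP (pos x) (pos y).
  by apply: path_graph_dist => //=; apply: posE; rewrite adj_sym.
by rewrite dist_le_sym; apply: path_graph_dist => //=; apply: posE.
Qed.

Lemma bandwidth_exists (G : graph) l : fits_path_power G l ->
  exists2 m, is_bandwidth G m & m <= l.
Proof.
elim/ltn_ind: l => l IH fl.
have [[m fm ml]|no] := classic (exists2 m, fits_path_power G m & m < l).
  by have [m' bm' m'm] := IH m ml fm; exists m' => //; lia.
exists l => //; split=> // m fm; rewrite leqNgt; apply/negP=> ml.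
by case: no; exists m.
Qed.

Lemma power_class_iso l G H :
  graph_iso G H -> fits_path_power G l -> fits_path_power H l.
Proof.
move=> /graph_iso_sym[f bf fE] /fits_path_powerP[pos pos_inj posE].
apply/fits_path_powerP; exists (pos \o f) => [|x y xy]; first exact: inj_comp (bij_inj bf).
by apply: posE; rewrite fE.
Qed.

Lemma power_class_empty l (G : graph) : #|G| = 0 -> fits_path_power G l.
Proof.
move=> G0; have nG (x : G) : False by have := fintype0 x G0.
by apply/fits_path_powerP; exists (fun=> 0) => x; case: (nG x).
Qed.

Definition power_class l : graph_class :=
  GraphClass (@power_class_iso l) (@power_class_empty l).

Lemma power_class_bounded l : bounded_bandwidth (power_class l).
Proof. by exists l => G /bandwidth_exists. Qed.

(** * From transductions of paths to perturbations *)

Lemma transduction_perturbation C : fo_transduction_of C paths ->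
  exists2 D : graph_class, bounded_bandwidth D & perturbation_of C D.
Proof.
move=> [[U k k_gt0 I] CT]; have [F [g [r far]]] := locality_far (eta I).
pose L : finType := ('I_k * {ffun F -> bool})%type.
pose T : finType := (L * {ffun 'I_(r + r).+1 * L -> bool})%type.
(* Vertex [i] of the path gets the numbers [i * k] to [i * k + k - 1] for its copies; near vertices
   are at most [2r + 1] path steps apart, and the copy index adds less than [k]. *)
pose b := (r + r).+1 * k + k.
exists (power_class b); first exact: power_class_bounded.
exists #|{set T}| => H /CT[G [n [f [fi fK fiK] fE]] [_ [c ->] /= iso_H]].
rewrite /= in c iso_H.
pose pos (x : copy k G) := val (fi x.1).
pose lett (x : copy k G) : L := (x.2, [ffun u => x \in c (g u)]).
have adjG v w : adj v w = ((fi v).+1 == fi w :> nat) || ((fi w).+1 == fi v :> nat).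
  by rewrite -{1}(fiK v) -{1}(fiK w) fE.
have lay : layout c g pos lett.
  split=> [[v s] [w t] /val_inj/(can_inj fiK) /= -> [->] //||u x x' [_ /ffunP/(_ u)]]; last first.
    by rewrite !ffunE.
  move=> [v s] [w t] [v' s'] [w' t'] [-> _] [-> _].
  rewrite /= /copy_adj /near /pos /= !adjG -!(inj_eq (can_inj fiK)) -!val_eqE /=.
  move=> H0; congr orb; last (by congr andb; lia); congr andb; lia.
have {}far := far _ _ _ _ _ lay.
pose W := window pos lett r.
(* By locality one far edge with given windows forces all far pairs with these windows to be
   edges. *)
pose s (t t' : T) := [exists x, exists y, [&& W x == t, W y == t',
  ~~ near pos (r + r).+1 x y & holds c (eta I) [tuple x; y]]].
have s_sym : symmetric s.
  suff imp t t' : s t t' -> s t' t by move=> t t'; apply/idP/idP; apply: imp.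
  case/existsP=> x /existsP[y /and4P[xt yt' fxy exy]].
  apply/existsP; exists y; apply/existsP; exists x.
  by rewrite xt yt' eta_sym exy near_sym fxy.
(* Adding [s] modulo 2 deletes every edge between far vertices, which leaves a graph of bandwidth at
   most [b]. *)
pose e0 (x y : interp I c) := adj x y (+) ((x != y) && s (W (val x)) (W (val y))).
have e0_sym : symmetric e0 by move=> x y; rewrite /e0 adj_sym s_sym eq_sym.
have e0_irr : irreflexive e0 by move=> x; rewrite /e0 adj_irr eqxx.
pose G0 := Graph e0_sym e0_irr.
have [H' pH' [h bh hE]] := perturbation_by_types (G := G0) (fun x => W (val x)) s_sym.
exists G0; last first.
  exists H' => //; apply: graph_iso_trans iso_H; exists h => // x y.
  by rewrite hE /= /e0 -addbA addbb addbF.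
apply/fits_path_powerP; exists (fun x => pos (val x) * k + (val x).2) => [x y e|x y].
  have [inj _ _] := lay; apply/val_inj; case: (val x) (val y) e => [v i] [w j] /= e.
  have ij : i = j by apply/val_inj; have := congr1 (modn^~ k) e; rewrite !modnMDl !modn_small.
  by move: e; rewrite ij => /addIn/eqP; rewrite eqn_pmul2r // => /eqP/val_inj/(can_inj fiK) /= ->.
have [nxy _|fxy] := boolP (near pos (r + r).+1 (val x) (val y)).
  have := ltn_ord (val x).2; case/andP: nxy => lxy _; rewrite /b => ltk.
  have : pos (val x) * k <= (pos (val y) + (r + r).+1) * k by rewrite leq_mul2r lxy orbT.
  by rewrite mulnDl; lia.
have [<-|nxy] := eqVneq x y; first by rewrite adj_irr.
rewrite /= /e0 nxy /= /interp_adj /=.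
suff -> : s (W (val x)) (W (val y)) = holds c (eta I) [tuple val x; val y] by rewrite addbb.
apply/existsP/idP => [[x' /existsP[y' /and4P[/eqP xx' /eqP yy' far' exy']]]|exy].
  by rewrite -(far _ _ _ _ xx' yy' far' fxy).
by exists (val x); apply/existsP; exists (val y); rewrite !eqxx fxy.
Qed.

(** * Coding graphs of bounded bandwidth in paths *)

(** [Residue a] marks the positions congruent to [a] modulo 3, which orients the
    path; [Link d] marks the vertices adjacent to the vertex [d] steps ahead. *)
Inductive color := Marked | Flip of nat | Residue of nat | Link of nat.

Definition for_ n (p q : formula color n) := FNot (FAnd (FNot p) (FNot q)).
Definition fxor n (p q : formula color n) := FAnd (for_ p q) (FNot (FAnd p q)).

Section Semantics.
Variables (G : graph) (c : coloring color G).

Lemma holds_or n (p q : formula color n) e :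
  holds c (for_ p q) e = holds c p e || holds c q e.
Proof. by rewrite /= negb_and !negbK. Qed.

Lemma holds_xor n (p q : formula color n) e :
  holds c (fxor p q) e = holds c p e (+) holds c q e.
Proof. by rewrite /=; case: (holds c p e) (holds c q e) => -[]. Qed.

End Semantics.

Fixpoint flip_formula k (base : formula color 2) : formula color 2 :=
  if k is k'.+1 then
    fxor (flip_formula k' base) (FAnd (FColor (Flip k') ord0) (FColor (Flip k') ord_max))
  else base.

Definition edge_formula k base :=
  FAnd (FNot (FEq color (ord0 : 'I_2) ord_max)) (flip_formula k base).

Lemma holds_edge k base (G : graph) (c : coloring color G) x y :
  holds c (edge_formula k base) [tuple x; y] =
  (x != y) && (holds c base [tuple x; y] (+)
    \big[addb/false]_(i < k) ((x \in c (Flip i)) && (y \in c (Flip i)))).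
Proof.
rewrite /edge_formula /=; congr andb; elim: k => [|k IH]; first by rewrite big_ord0 addbF.
by rewrite [flip_formula _ _]/= holds_xor IH big_ord_recr addbA.
Qed.

Section EdgeInterpretation.
Variables (k : nat) (base : formula color 2).
Hypothesis base_sym : forall (G : graph) (c : coloring color G) x y,
  holds c base [tuple x; y] = holds c base [tuple y; x].

Lemma edge_formula_sym (G : graph) (c : coloring color G) x y :
  holds c (edge_formula k base) [tuple x; y] = holds c (edge_formula k base) [tuple y; x].
Proof.
rewrite !holds_edge eq_sym base_sym; congr (_ && (_ (+) _)).
by apply: eq_bigr => i _; rewrite andbC.
Qed.

Lemma edge_formula_irr (G : graph) (c : coloring color G) x :
  holds c (edge_formula k base) [tuple x; x] = false.
Proof. by rewrite holds_edge eqxx. Qed.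

Definition edge_interp := @SimpleInterp color (FColor Marked ord0) (edge_formula k base)
  edge_formula_sym edge_formula_irr.

Definition edge_transduction := @Transduction color 1 isT edge_interp.

(** Shared by both constructions: it is enough to place [H] on the marked vertices so that the base
    relation, corrected by the flips, gives its edges. *)
Lemma edge_transduction_iso (G H : graph) (c : coloring color (copy 1 G)) (h : H -> copy 1 G) :
  injective h -> (forall x, (x \in c Marked) = (x \in codom h)) ->
  (forall x y, x != y -> adj x y = holds c base [tuple h x; h y] (+)
    \big[addb/false]_(i < k) ((h x \in c (Flip i)) && (h y \in c (Flip i)))) ->
  exists2 H', transduce edge_transduction G H' & graph_iso H' H.
Proof.
move=> h_inj markE adjE; exists (interp edge_interp c); first by exists c.
apply: graph_iso_sym.
have marked x : holds c (nu edge_interp) [tuple h x].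
  by change (h x \in c Marked); rewrite markE codom_f.
pose h' x : interp edge_interp c := exist _ (h x) (marked x).
exists h'; last first.
  move=> x y; rewrite /= /interp_adj [LHS]holds_edge /= (inj_eq h_inj).
  by case: (eqVneq x y) => [->|nxy]; [rewrite adj_irr|rewrite (adjE _ _ nxy)].
have h'_inj : injective h' by move=> x y [/h_inj].
apply: inj_card_bij => //; rewrite -(card_codom h_inj) card_sig.
by apply: subset_leq_card; apply/subsetP => x; rewrite -markE.
Qed.

End EdgeInterpretation.

(** * Reading edges off a coloured path *)

Definition arc_formula n (i j : 'I_n) : formula color n :=
  FAnd (FAdj color i j)
    (for_ (FAnd (FColor (Residue 0) i) (FColor (Residue 1) j))
    (for_ (FAnd (FColor (Residue 1) i) (FColor (Residue 2) j))
          (FAnd (FColor (Residue 2) i) (FColor (Residue 0) j)))).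

Fixpoint ahead_formula d n : 'I_n -> 'I_n -> formula color n :=
  if d is d'.+1 then fun i j =>
    FEx (FAnd (arc_formula (lift ord0 i) ord0) (ahead_formula d' ord0 (lift ord0 j)))
  else @FEq color n.

Fixpoint link_formula b (i j : 'I_2) : formula color 2 :=
  let p := FAnd (FColor (Link b) i) (ahead_formula b i j) in
  if b is b'.+1 then for_ (link_formula b' i j) p else p.

Definition link_base b := for_ (link_formula b ord0 ord_max) (link_formula b ord_max ord0).

(** The truth value depends only on the two elements named, in every coloured graph: [eta_sym]
    requires symmetry of the formula even where the colours code no path. *)
Lemma holds_ahead_local (G : graph) (c : coloring color G) d n (i j : 'I_n) e
    n' (i' j' : 'I_n') e' :
  tnth e i = tnth e' i' -> tnth e j = tnth e' j' ->
  holds c (ahead_formula d i j) e = holds c (ahead_formula d i' j') e'.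
Proof.
elim: d n i j e n' i' j' e' => [|d IH] n i j e n' i' j' e' ei ej /=; first by rewrite ei ej.
apply: eq_existsb => x; rewrite !tnthS !tnth0 ei; congr andb.
by apply: IH; rewrite ?tnth0 ?tnthS.
Qed.

Lemma holds_link_local (G : graph) (c : coloring color G) b (i j i' j' : 'I_2) e e' :
  tnth e i = tnth e' i' -> tnth e j = tnth e' j' ->
  holds c (link_formula b i j) e = holds c (link_formula b i' j') e'.
Proof.
move=> ei ej; have E d : holds c (FAnd (FColor (Link d) i) (ahead_formula d i j)) e =
    holds c (FAnd (FColor (Link d) i') (ahead_formula d i' j')) e'.
  by rewrite /= ei; congr andb; apply: holds_ahead_local.
elim: b => [|b IH]; first exact: E.
by rewrite [link_formula _ i j]/= [link_formula _ i' j']/= !holds_or IH E.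
Qed.

Lemma link_base_sym b (G : graph) (c : coloring color G) x y :
  holds c (link_base b) [tuple x; y] = holds c (link_base b) [tuple y; x].
Proof. by rewrite !holds_or orbC; congr orb; apply: holds_link_local. Qed.

Section PathCoding.
Variables (m : nat) (c : coloring color (copy 1 (path_graph m))).
Hypothesis residueE : forall a x, (x \in c (Residue a)) = (val x.1 %% 3 == a).

Lemma holds_arc n (i j : 'I_n) e : holds c (arc_formula i j) e =
  (val (tnth e j).1 == (val (tnth e i).1).+1).
Proof.
rewrite /= !residueE; case: (tnth e i) (tnth e j) => [[v vm] s] [[w wm] t] /=.
by rewrite (ord1 s) (ord1 t) /copy_adj /= /path_adj /= andbF orbF; lia.
Qed.

Lemma holds_ahead d n (i j : 'I_n) e : holds c (ahead_formula d i j) e =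
  (val (tnth e j).1 == val (tnth e i).1 + d).
Proof.
elim: d n i j e => [|d IH] n i j e.
  rewrite /= addn0; apply/eqP/eqP => [-> //|].
  case: (tnth e i) (tnth e j) => [v s] [w t] /= /val_inj ->.
  by rewrite (ord1 s) (ord1 t).
rewrite [ahead_formula _ _ _]/=; apply/existsP/eqP => [[x]|eij].
  change (holds c (arc_formula (lift ord0 i) ord0) [tuple of x :: e] &&
    holds c (ahead_formula d ord0 (lift ord0 j)) [tuple of x :: e] ->
    val (tnth e j).1 = val (tnth e i).1 + d.+1).
  by rewrite holds_arc IH !tnthS !tnth0 => /andP[/eqP -> /eqP ->]; lia.
have lt_m : (val (tnth e i).1).+1 < m.
  apply: leq_ltn_trans (ltn_ord (tnth e j).1).
  by rewrite -[X in _ <= X]/(val _) eij addnS ltnS leq_addr.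
exists (Ordinal lt_m, ord0).
set x := (_, _).
change (holds c (arc_formula (lift ord0 i) ord0) [tuple of x :: e] &&
    holds c (ahead_formula d ord0 (lift ord0 j)) [tuple of x :: e]).
by rewrite holds_arc IH !tnthS !tnth0 eqxx /= eij addnS.
Qed.

Lemma holds_link b (i j : 'I_2) e : holds c (link_formula b i j) e =
  [exists d : 'I_b.+1, (tnth e i \in c (Link d)) && (val (tnth e j).1 == val (tnth e i).1 + d)].
Proof.
have E d : holds c (FAnd (FColor (Link d) i) (ahead_formula d i j)) e =
  (tnth e i \in c (Link d)) && (val (tnth e j).1 == val (tnth e i).1 + d).
  by rewrite -holds_ahead.
elim: b => [|b IH].
  rewrite [LHS]E; apply/idP/existsP => [H|[d]]; first by exists ord0.
  by rewrite (ord1 d).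
rewrite [link_formula _ _ _]/= holds_or IH E; apply/orP/existsP.
  by case=> [/existsP[d H]|H]; [exists (widen_ord (leqnSn _) d)|exists ord_max].
case=> d H; case: (unliftP ord_max d) H => [d'|] -> H; last by right.
by left; apply/existsP; exists d'; rewrite lift_max in H.
Qed.

End PathCoding.

Lemma perturbation_transduction (C D : graph_class) :
  bounded_bandwidth D -> perturbation_of C D -> fo_transduction_of C paths.
Proof.
move=> [b Db] [k Ck]; exists (edge_transduction k (@link_base_sym b)) => H /Ck[G DG [H' GH' isoH]].
have [l [/fits_path_powerP[pos pos_inj posE] _] lb] := Db G DG.
have [Ms [f [bf fE]]] := perturbation_sets GH'.
pose m := (\max_x pos x).+1.
have lt_pos x : pos x < m by rewrite ltnS leq_bigmax.
exists (path_graph m); first by exists m; apply: graph_iso_refl.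
pose h x : copy 1 (path_graph m) := (Ordinal (lt_pos (f x)), ord0).
have h_inj : injective h by move=> x y [/pos_inj/(bij_inj bf)].
(* Marking drops the path vertices that fill gaps of [pos]; each edge is recorded at its lower
   end. *)
pose c (u : color) : {set copy 1 (path_graph m)} := match u with
  | Marked => [set x in codom h]
  | Flip i => [set x | [exists y, (h y == x) && (f y \in nth set0 Ms i)]]
  | Residue a => [set x : copy 1 (path_graph m) | val x.1 %% 3 == a]
  | Link d => [set x | [exists y, exists z,
      [&& h y == x, pos (f z) == pos (f y) + d & adj (f y) (f z)]]]
  end.
have [|x y nxy|H'' TH'' isoH''] :=
  edge_transduction_iso (H := H') (c := c) (k := k) (@link_base_sym b) h_inj.
- by move=> x; rewrite /c inE.
- have flipE i z : (h z \in c (Flip i)) = (f z \in nth set0 Ms i).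
    rewrite inE; apply/existsP/idP => [[z' /andP[/eqP/h_inj -> //]]|fz].
    by exists z; rewrite eqxx.
  rewrite fE; congr addb; last first.
    rewrite /compl_all big_tuple; apply: eq_bigr => i _.
    by rewrite !flipE (inj_eq (bij_inj bf)) nxy (tnth_nth set0).
  have residueE a z : (z \in c (Residue a)) = (val z.1 %% 3 == a) by rewrite inE.
  (* Since [pos] is injective, the length of a link determines its other end. *)
  have linkE u v (d : nat) : (h u \in c (Link d)) && (val (h v).1 == val (h u).1 + d) =
      (pos (f v) == pos (f u) + d) && adj (f u) (f v).
    rewrite inE /= andbC; apply: andb_id2l => /eqP pv.
    apply/existsP/idP => [[u' /existsP[v' /and3P[/eqP/h_inj -> /eqP pv' uv]]]|uv].
      by move: pv; rewrite -pv' => /pos_inj ->.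
    by exists u; apply/existsP; exists v; rewrite pv !eqxx.
  rewrite holds_or !holds_link //.
  apply/idP/orP => [xy|].
    have leb u v : adj (f u) (f v) -> pos (f v) <= pos (f u) ->
        [exists d : 'I_b.+1, (h v \in c (Link d)) && (val (h u).1 == val (h v).1 + d)].
      move=> uv le; have lt_b : pos (f u) - pos (f v) < b.+1.
        by rewrite ltnS leq_subLR; apply: leq_trans (posE _ _ uv) _; rewrite leq_add2l.
      by apply/existsP; exists (Ordinal lt_b); rewrite linkE /= subnKC // eqxx adj_sym.
    have [le|/ltnW le] := leqP (pos (f x)) (pos (f y)); last by right; apply: leb.
    by left; apply: leb => //; rewrite adj_sym.
  by case=> /existsP[d]; rewrite linkE => /andP[_]; rewrite 1?adj_sym.
by exists H'' => //; apply: graph_iso_trans isoH'' isoH.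
Qed.

(** * Long induced paths *)

Section Levels.
Variables (G : graph) (x : G).

Fixpoint walk n (y : G) : bool :=
  if n is n'.+1 then [exists z, walk n' z && adj z y] else x == y.

Definition level n y := walk n y && [forall m : 'I_n, ~~ walk m y].

Lemma levelP n y : reflect (walk n y /\ forall m, walk m y -> n <= m) (level n y).
Proof.
apply: (iffP andP) => -[wn min]; split=> //; last first.
  by apply/forallP => m; apply: contraL (ltn_ord m) => /min; rewrite leqNgt.
move=> m wm; rewrite leqNgt; apply: contraL wm => mn.
exact: forallP min (Ordinal mn).
Qed.

Lemma walk_adj n y z : walk n y -> adj y z -> walk n.+1 z.
Proof. by move=> wy yz; apply/existsP; exists y; apply/andP. Qed.

Lemma level_exists y : connect (@adj G) x y -> exists n, level n y.
Proof.
move=> xy; suff ex : exists n, walk n y.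
  by case: (ex_minnP ex) => n wn min; exists n; apply/levelP.
case/connectP: xy => p pp ->; elim/last_ind: p pp => [|p z IH].
  by exists 0; rewrite /= eqxx.
by rewrite rcons_path last_rcons => /andP[/IH[n wn] /(walk_adj wn) wz]; exists n.+1.
Qed.

Lemma level_adj m n y z : level m y -> level n z -> adj y z -> n <= m.+1.
Proof. by move=> /levelP[wy _] /levelP[_ min] yz; apply/min/(walk_adj wy). Qed.

Lemma level_inj m n y : level m y -> level n y -> m = n.
Proof.
by move=> /levelP[wm mm] /levelP[wn mn]; apply/eqP; rewrite eqn_leq mm ?mn.
Qed.

Lemma level_path n y : level n y -> exists v : nat -> G,
  [/\ v n = y, forall i, i <= n -> level i (v i) & forall i, i < n -> adj (v i) (v i.+1)].
Proof.
elim: n y => [|n IH] y ly.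
  by exists (fun=> y); split=> // i; rewrite leqn0 => /eqP ->.
have /levelP[/existsP[z /andP[wz zy]] min] := ly.
have [|v [vn lv av]] := IH z.
  by apply/levelP; split=> // m /walk_adj/(_ zy)/min.
exists (fun i => if i <= n then v i else y); split=> [|i le|i le].
- by rewrite ltnn.
- have [/lv //|lt] := leqP i n.
  by have -> : i = n.+1 by lia.
- rewrite -ltnS le; have [/av //|ge] := ltnP i n.
  by have -> : i = n by [lia]; rewrite vn.
Qed.

(** A shortest path is induced: its vertices lie on distinct levels, and adjacent vertices are at
    most one level apart. *)
Lemma level_induced_path n y : level n y -> exists v : nat -> G,
  forall i j, i <= n -> j <= n ->
    (v i = v j -> i = j) /\ adj (v i) (v j) = (i.+1 == j) || (j.+1 == i).
Proof.
case/level_path=> v [_ lv av]; exists v => i j le_i le_j.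
split=> [e|]; first by apply: level_inj (lv i le_i) _; rewrite e; apply: lv.
apply/idP/orP => [vij|[/eqP e|/eqP e]]; last 2 first.
- by rewrite -e; apply: av; rewrite e.
- by rewrite -e adj_sym; apply: av; rewrite e.
have lji := level_adj (lv i le_i) (lv j le_j) vij.
have lij : i <= j.+1 by apply: level_adj (lv j le_j) (lv i le_i) _; rewrite adj_sym.
have nij : i != j by apply: contraTneq vij => ->; rewrite adj_irr.
suff : (i.+1 == j) || (j.+1 == i) by move/orP.
lia.
Qed.

Variables (pos : G -> nat) (b : nat).
Hypotheses (pos_inj : injective pos) (posE : forall y z, adj y z -> pos y <= pos z + b).

Lemma walk_pos n y : walk n y -> pos y <= pos x + n * b /\ pos x <= pos y + n * b.
Proof.
elim: n y => [|n IH] y /=; first by move/eqP => ->; rewrite addn0.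
case/existsP=> z /andP[/IH[le1 le2] zy]; rewrite mulSn.
have := posE zy; have := posE (etrans (adj_sym y z) zy); lia.
Qed.

(** If no vertex reaches level [n], the whole component lies within [n * b] of [x] in the numbering
    and has at most [2nb + 1] vertices. *)
Lemma long_induced_path n : (n * b).*2.+1 < #|connect (@adj G) x| ->
  exists v : nat -> G, forall i j, i <= n -> j <= n ->
    (v i = v j -> i = j) /\ adj (v i) (v j) = (i.+1 == j) || (j.+1 == i).
Proof.
move=> large.
have [[y [m [lvl nm]]]|small] := classic (exists y m, level m y /\ n <= m).
  have [v vE] := level_induced_path lvl.
  by exists v => i j le_i le_j; apply: vE; lia.
suff : #|connect (@adj G) x| <= (n * b).*2.+1 by rewrite leqNgt large.
pose f y : 'I_(n * b).*2.+1 := inord (pos y + n * b - pos x).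
have close y : connect (@adj G) x y -> pos y <= pos x + n * b /\ pos x <= pos y + n * b.
  case/level_exists=> m lvl; have /levelP[/walk_pos[le1 le2] _] := lvl.
  have : m * b <= n * b.
    by rewrite leq_mul2r ltnW ?orbT // ltnNge; apply/negP => nm; case: small; exists y, m.
  by lia.
rewrite -[X in _ <= X]card_ord -(card_in_imset (f := f)); first exact: max_card.
move=> y z /close cy /close cz /(congr1 val); rewrite /f /= !inordK; [|lia|lia].
by move=> e; apply: pos_inj; lia.
Qed.

End Levels.

Lemma adj_base_sym (G : graph) (c : coloring color G) x y :
  holds c (FAdj color (ord0 : 'I_2) ord_max) [tuple x; y] =
  holds c (FAdj color (ord0 : 'I_2) ord_max) [tuple y; x].
Proof. exact: adj_sym. Qed.

Lemma paths_transduction (C D : graph_class) :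
  bounded_bandwidth D -> large_components D -> tight_perturbation_of C D ->
  fo_transduction_of paths C.
Proof.
move=> [b Db] largeD [k [_ DC]]; exists (edge_transduction k adj_base_sym) => Q [n iso_Q].
have [G DG [x large_x]] := largeD (n * b).*2.+2.
have [l [/fits_path_powerP[pos pos_inj posE] _] lb] := Db G DG.
have [H CH /perturbation_sets[Ms [f [[f' fK f'K] fE]]]] := DC G DG.
have posE' y z : adj y z -> pos y <= pos z + b.
  by move/posE => le; apply: leq_trans le _; rewrite leq_add2l.
have [v vE] := long_induced_path pos_inj posE' large_x.
exists H => //.
pose h (i : path_graph n) : copy 1 H := (f' (v i), ord0).
have h_inj : injective h.
  move=> i j [/(can_inj f'K) e]; apply/val_inj.
  by have [/(_ e)] := vE i j (ltnW (ltn_ord i)) (ltnW (ltn_ord j)).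
(* Repeating the same complementations on [H] cancels them and restores the edges of [G]. *)
pose c (u : color) : {set copy 1 H} := match u with
  | Marked => [set z in codom h]
  | Flip i => [set z : copy 1 H | f z.1 \in nth set0 Ms i]
  | _ => set0
  end.
have [|i j nij|H' TH' isoH'] :=
  edge_transduction_iso (H := path_graph n) (c := c) (k := k) adj_base_sym h_inj.
- by move=> z; rewrite inE.
- have [_ vij] := vE i j (ltnW (ltn_ord i)) (ltnW (ltn_ord j)).
  have -> : adj i j = adj (v i) (v j) by rewrite vij.
  have nvij : v i != v j.
    by apply: contraNneq nij => e; apply/eqP/h_inj; rewrite /h e.
  rewrite [holds _ _ _]/= /copy_adj /= andbF orbF fE !f'K -addbA.
  rewrite /compl_all big_tuple -big_split big1 ?addbF // => m _.
  by rewrite !inE /= !f'K nvij (tnth_nth set0) addbb.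
by exists H' => //; apply: graph_iso_trans isoH' iso_Q.
Qed.

(** * Bounded components *)

(* Cut the path into many intervals longer than [m]. Each contains an edge
   between two blocks of [p]; among sufficiently many such edges, [m.+2] have the
   same types, so the tail of one is adjacent to the heads of all the others
   outside its own block. *)
Lemma path_not_blockwise_typed (T : finType) m : exists N, forall (p : nat -> nat) (t : nat -> T),
  (forall v s, uniq s -> all (fun i => (i < N) && (p i == v)) s -> size s <= m) ->
  (forall i j i' j', i < N -> j < N -> i' < N -> j' < N -> t i = t i' -> t j = t j' ->
     p i != p j -> p i' != p j' ->
     (i.+1 == j) || (j.+1 == i) = ((i'.+1 == j') || (j'.+1 == i'))) ->
  False.
Proof.
(* [W] intervals of [m + 2] vertices: by pigeonhole, more than [m + 1] of their crossing edges have
   the same pair of types. *)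
pose W := (#|{: T * T}| * m.+1).+1; exists (W * m.+2) => p t small_block typed.
have inside (w : 'I_W) i : i <= m.+1 -> w * m.+2 + i < W * m.+2.
  move=> le_i; have : w.+1 * m.+2 <= W * m.+2 by rewrite leq_mul2r ltn_ord orbT.
  by rewrite mulSn; lia.
(* Without a crossing edge, [m + 1] consecutive vertices would share a block. *)
have cross (w : 'I_W) : exists i, [/\ w * m.+2 <= i, i.+1 <= w * m.+2 + m & p i != p i.+1].
  apply: NNPP => no.
  have const i : i <= m -> p (w * m.+2 + i) = p (w * m.+2).
    elim: i => [|i IH] le_i; first by rewrite addn0.
    rewrite -IH; last by lia.
    apply/eqP; apply: contraT => ne; case: no; exists (w * m.+2 + i).
    by split; [lia|lia|rewrite eq_sym -addnS].
  have := small_block (p (w * m.+2)) (iota (w * m.+2) m.+1) (iota_uniq _ _).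
  rewrite size_iota ltnn => H; suff : false by []; apply: H.
  apply/allP=> i; rewrite mem_iota => /andP[le_i lt_i].
  have -> : i = w * m.+2 + (i - w * m.+2) by lia.
  by rewrite inside ?const ?eqxx //; lia.
have [f fP] := fin_all_exists cross.
(* The slack at the end of each interval keeps the chosen edges apart, so that no end of one is
   adjacent to an end of another. *)
have gap (w w' : 'I_W) : w < w' -> (f w).+3 <= f w'.
  move=> lt; have [_ + _] := fP w; have [+ _ _] := fP w'.
  have : w.+1 * m.+2 <= w' * m.+2 by rewrite leq_mul2r lt orbT.
  by rewrite mulSn; lia.
have f_inj : injective f.
  by move=> w w' e; apply/val_inj; case: (ltngtP w w') => // /gap; rewrite e; lia.
have f_lt w : (f w).+1 < W * m.+2.
  have [le le' _] := fP w.
  have -> : (f w).+1 = w * m.+2 + ((f w).+1 - w * m.+2) by lia.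
  by apply: inside; lia.
pose key w := (t (f w), t (f w).+1).
have [tt big_tt] : exists tt, m.+1 < #|[set w | key w == tt]|.
  apply: NNPP => no; have : W <= #|{: T * T}| * m.+1; last by rewrite ltnn.
  rewrite -[X in X <= _]card_ord -sum1_card (partition_big key predT) //= -sum_nat_const.
  apply: leq_sum => tt _; rewrite sum1_card leqNgt; apply/negP => H; case: no.
  by exists tt; rewrite cardsE.
have /card_gt0P[w0 w0A] : 0 < #|[set w | key w == tt]| by lia.
move: big_tt; rewrite (cardsD1 w0) w0A add1n ltnS ltnNge => /negP; apply.
(* The heads of the other edges, more than [m] by assumption, all fall into the block of [f w0]. *)
rewrite cardE -(size_map (fun w => (f w).+1)); apply: (small_block (p (f w0))).
  by rewrite map_inj_uniq ?enum_uniq // => w w' [/f_inj].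
apply/allP => _ /mapP[w + ->]; rewrite mem_enum !inE => /andP[ww0 /eqP kw].
rewrite f_lt /=; apply: contraT => ne.
move: w0A; rewrite inE -kw => /eqP[e1 e2].
have [_ _ ne0] := fP w0.
have := typed (f w0) (f w).+1 (f w0) (f w0).+1 (ltnW (f_lt _)) (f_lt _) (ltnW (f_lt _)) (f_lt _)
  erefl (esym e2).
rewrite eq_sym => /(_ ne ne0); rewrite eqxx /=.
by case: (ltngtP w w0) => [/gap|/gap|/val_inj e]; [lia|lia|rewrite e eqxx in ww0].
Qed.

(** * Adjacency inside a connected component *)

Section Components.
Variable G : graph.

Definition component (v : G) : seq G := enum [pred w | root (@adj G) w == root (@adj G) v].

Let adj_connect_sym : connect_sym (@adj G) := sym_connect_sym (@adj_sym G).

Lemma component_size v : size (component v) = #|connect (@adj G) v|.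
Proof.
rewrite -cardE; apply: eq_card => w.
by rewrite !inE (root_connect adj_connect_sym) adj_connect_sym.
Qed.

Lemma component_root v w : root (@adj G) v = root (@adj G) w -> component v = component w.
Proof. by rewrite /component => ->. Qed.

Lemma mem_component v : v \in component v.
Proof. by rewrite mem_enum inE. Qed.

(** Beyond the end of the list the default [v] gives [false], by irreflexivity. *)
Definition component_row n (v : G) : {ffun 'I_n -> bool} :=
  [ffun j : 'I_n => adj v (nth v (component v) j)].

Lemma adj_component n (v w : G) (i : 'I_n) : i = index w (component w) :> nat ->
  adj v w = (root (@adj G) v == root (@adj G) w) && component_row n v i.
Proof.
move=> iE; case: eqP => [vw|nvw] /=.
  by rewrite ffunE iE (component_root vw) nth_index // mem_component.
apply/negbTE; apply/negP => vw; case: nvw.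
by apply/eqP; rewrite (root_connect adj_connect_sym) connect1.
Qed.

Lemma eq_component (v w : G) : (v == w) = (root (@adj G) v == root (@adj G) w) &&
  (index v (component v) == index w (component w)).
Proof.
apply/eqP/andP => [->|[/eqP vw /eqP e]]; first by rewrite !eqxx.
rewrite -(nth_index v (mem_component v)) -(nth_index v (mem_component w)).
by rewrite -e (component_root vw).
Qed.

End Components.

Lemma transduction_paths_components (C D : graph_class) n :
  perturbation_of C D -> fo_transduction_of paths C ->
  ~ (forall G, D G -> forall x : G, #|connect (@adj G) x| < n).
Proof.
move=> [k CD] [[U q q_gt0 I] CT] small; have [F [g [r far]]] := locality_far (eta I).
(* A letter holds the copy, the index in the component, the adjacencies inside it, the complemented
   sets and the colours of a vertex. *)
pose L : finType :=
  ('I_q * 'I_n * {ffun 'I_n -> bool} * {ffun 'I_k -> bool} * {ffun F -> bool})%type.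
pose T : finType := (L * {ffun 'I_(r + r).+1 * L -> bool})%type.
(* Elements of one block share a position and so have distinct letters, whence the bound [#|L|]. *)
have [N impossible] := path_not_blockwise_typed T #|L|.
have [|H CH [_ [c ->] /= iso_N]] := CT (path_graph N.+1).
  by exists N.+1; apply: graph_iso_refl.
have [G DG [H' /perturbation_sets[Ms [f' [bf' fE']]] isoH]] := CD H CH.
have [h bh hE] := graph_iso_sym isoH.
pose f x := f' (h x); have f_inj : injective f by apply: inj_comp (bij_inj bf') (bij_inj bh).
have fE x y : adj x y = adj (f x) (f y) (+) compl_all Ms (f x) (f y).
  by rewrite -hE fE'.
rewrite /= in c iso_N.
have idx_lt (v : G) : index v (component v) < n.
  by apply: leq_trans (small G DG v); rewrite -component_size ltnS ltnW // index_mem mem_component.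
pose idx v : 'I_n := Ordinal (idx_lt v).
pose comp (x : copy q H) := root (@adj G) (f x.1).
(* Consecutive components are too far apart for a window to see two of them. *)
pose pos (x : copy q H) := enum_rank (comp x) * (r + r).+2.
pose lett (x : copy q H) : L := (x.2, idx (f x.1), component_row n (f x.1),
  [ffun i => f x.1 \in tnth Ms i], [ffun u => x \in c (g u)]).
have pos_eq x y : (pos x == pos y) = (comp x == comp y).
  by rewrite eqn_pmul2r // val_eqE (inj_eq enum_rank_inj).
have nearE l x y : l <= (r + r).+1 -> near pos l x y = (comp x == comp y).
  move=> le_l; apply/idP/idP => [|/eqP e]; last first.
    by rewrite /near /pos e !leq_addr.
  rewrite -pos_eq /near /pos => /andP[le1 le2]; rewrite eqn_pmul2r //.
  have lt1 a b : a * (r + r).+2 <= b * (r + r).+2 + l -> a <= b.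
    by move=> le; rewrite -ltnS -(ltn_pmul2r (m := (r + r).+2)) // mulSn; lia.
  by rewrite eqn_leq; apply/andP; split; apply: lt1.
have eq_vert (x y : copy q H) : (x.1 == y.1) =
    (comp x == comp y) && ((lett x).1.1.1.2 == (lett y).1.1.1.2).
  by rewrite -(inj_eq f_inj) eq_component.
(* Adjacency is a function of the two letters and of whether the components coincide; the
   complementations need not be undone. *)
have adjE (x y : copy q H) : adj x y =
    ((lett x).1.1.1.1 == (lett y).1.1.1.1) &&
      (((comp x == comp y) && (lett x).1.1.2 (lett y).1.1.1.2) (+)
       \big[addb/false]_(i < k)
         [&& ~~ ((comp x == comp y) && ((lett x).1.1.1.2 == (lett y).1.1.1.2)),
             (lett x).1.2 i & (lett y).1.2 i]) ||
    ((comp x == comp y) && ((lett x).1.1.1.2 == (lett y).1.1.1.2)) &&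
      ((lett x).1.1.1.1 != (lett y).1.1.1.1).
  rewrite -eq_vert /= /copy_adj /= fE (@adj_component _ n _ _ (idx (f y.1))) //.
  congr (_ && (_ (+) _) || _); rewrite /compl_all big_tuple.
  by apply: eq_bigr => i _; rewrite (inj_eq f_inj) !ffunE.
have lay : layout c g pos lett.
  split=> [x y /eqP|x y x' y' lx ly|u x x' /(congr1 (fun l : L => l.2 u))]; last first.
  - by rewrite !ffunE.
  - rewrite !nearE // => same; rewrite !adjE lx ly.
    suff -> : (comp x == comp y) = (comp x' == comp y') by [].
    move: same; rewrite -!pos_eq; move: (pos x) (pos y) (pos x') (pos y'); lia.
  rewrite pos_eq => e l; have : x.1 == y.1 by rewrite eq_vert e l eqxx.
  by move: l; case: x y {e} => [x i] [y j] [-> _ _ _ _] /= /eqP ->.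
have {}far := far _ _ _ _ _ lay.
have [v bv vE] := graph_iso_sym iso_N.
pose z i := val (v (inord i)).
have z_inj i j : i < N -> j < N -> z i = z j -> i = j.
  by move=> ? ? /val_inj/(bij_inj bv)/(congr1 val); rewrite /= !inordK //; lia.
apply: (impossible (fun i => pos (z i)) (fun i => window pos lett r (z i))).
  move=> p s us /allP sP; have [inj _ _] := lay.
  rewrite -(size_map (fun i => lett (z i))) -(card_uniqP _) ?max_card //.
  rewrite map_inj_in_uniq // => i j /sP/andP[lt_i /eqP pi] /sP/andP[lt_j /eqP pj] e.
  by apply: z_inj => //; apply: inj; rewrite ?pi ?pj.
move=> i j i' j' lti ltj lti' ltj' ti tj pij pij'.
have adjz a b : a < N -> b < N -> (a.+1 == b) || (b.+1 == a) = holds c (eta I) [tuple z a; z b].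
  move=> lta ltb; have := vE (inord a) (inord b).
  by rewrite /= /path_adj /= !inordK => [<- //||]; lia.
rewrite !adjz //; apply: far => //; rewrite nearE // -pos_eq //.
Qed.

Lemma equivalent_tight_perturbation (C : graph_class) :
  fo_transduction_of C paths -> fo_transduction_of paths C ->
  exists D : graph_class, [/\ bounded_bandwidth D, large_components D & tight_perturbation_of C D].
Proof.
move=> /transduction_perturbation[D0 [b D0b] [k CD0]] pathsC.
(* Keeping only the graphs that some perturbation takes into [C] makes the perturbation tight. *)
pose inD G := D0 G /\ exists2 H, C H & perturbation k G H.
have inD_iso G G' : graph_iso G G' -> inD G -> inD G'.
  move=> isoG [D0G [H CH pH]]; split; first exact: class_iso isoG D0G.
  have [H' pH' isoH] := perturbation_iso isoG pH.
  by exists H' => //; apply: class_iso isoH CH.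
have inD_empty (G : graph) : #|G| = 0 -> inD G.
  move=> G0; split; first exact: class_empty.
  (* The empty graph stays: complementing [set0] repeatedly yields an empty graph, which [C]
     contains. *)
  have [H pH [f bf _]] := @perturbation_exists G (nseq k set0).
  rewrite size_nseq in pH; exists H => //; apply: class_empty.
  by rewrite (bij_eq_card bf).
pose D := GraphClass inD_iso inD_empty.
have tight : tight_perturbation_of C D.
  exists k; split=> [H CH|G [_ HP]] //.
  have [G D0G [H' pH' isoH]] := CD0 H CH.
  exists G; last by exists H'.
  by split=> //; exists H' => //; apply: class_iso (graph_iso_sym isoH) CH.
exists D; split=> //; first by exists b => G [/D0b].
move=> n; apply: NNPP => no.
have CD : perturbation_of C D by have [k' [CD _]] := tight; exists k'.
apply: (transduction_paths_components (n := n) CD pathsC) => G DG x.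
by rewrite ltnNge; apply/negP => ge; case: no; exists G => //; exists x.
Qed.

Theorem proposition15p1 :
  (forall C : graph_class,
     fo_transduction_of C paths <->
     exists2 D : graph_class, bounded_bandwidth D & perturbation_of C D) /\
  (forall C : graph_class,
     fo_transduction_of C paths ->
     (fo_equivalent C paths <->
      exists D : graph_class,
        [/\ bounded_bandwidth D, large_components D &
            tight_perturbation_of C D])).
Proof.
split=> [C|C CP].
  by split=> [|[D bD CD]]; [exact: transduction_perturbation|exact: perturbation_transduction CD].
split=> [[_ PC]|[D [bD lD tD]]]; first exact: equivalent_tight_perturbation.
by split=> //; apply: paths_transduction tD.
Qed.
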